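(* Let $P=A\sqcup B$ be a finite poset that is the disjoint union of two chains $A=\{1\prec2\prec\cdots\prec a\}$ and $B=\{1'\prec2'\prec\cdots\prec b'\}$, let $L=\mathcal{J}(P)$, and let $L'$ be the lattice of maximal chains of $L$ ordered by $\preceq_{\mathrm{ch}}$. Then $L'$ is isomorphic to an interval $[\mu,\lambda]$ of Young's lattice. More precisely, under the identification of maximal chains of $L$ with integer partitions described in the context, the minimal and maximal elements of $L'$ are given by the integer partitions $\mu=(\mu_b,\ldots,\mu_1)$ and $\lambda=(\lambda_b,\ldots,\lambda_1)$ where, for $i=1,\ldots,b$, $$\mu_i=|A\cap(i')|,\qquad \lambda_i=\max\{k\in A : i'\notin(k)\},$$ with $\lambda_i=0$ if there is no such $k\in A$.
   Context: An ideal of $P$ is a downward closed subset; $\mathcal{J}(P)$ is the lattice of ideals of $P$ ordered by inclusion. For $p\in P$, $(p)$ denotes the smallest ideal of $P$ containing $p$. Elements of $A$ and $B$ may satisfy further relations in $P$. An ideal $I\in L$ is identified with the point $(|I\cap A|,|I\cap B|)\in\mathbb{N}^2$ (this is injective), and labelled $t_{ij}$ if the point is $(i,j)$. The rank of $t_{ij}$ is $i+j$. Maximal chains of $L$ are lattice paths from $(0,0)$ to $(a,b)$ with steps $(i,j)\to(i+1,j)$ and $(i,j)\to(i,j+1)$ through points of $L$. For maximal chains $C=\{c_0\prec\cdots\prec c_r\}$ and $D=\{d_0\prec\cdots\prec d_r\}$, $r=a+b$, with $c_k,d_k$ of rank $k$, set $C\preceq_{\mathrm{ch}}D$ iff for all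 $k$ the first coordinate of $c_k$ is at most the first coordinate of $d_k$ (i.e. $C$ lies weakly above and to the left of $D$). A cell is a $1\times1$ square with integer corners. In the rectangle with bottom left corner $(0,0)$ and top right corner $(a,b)$, rows of cells are numbered from row $1$ (bottom) to row $b$ (top). A lattice path $C$ from $(0,0)$ to $(a,b)$ is identified with the integer partition $(\lambda_b,\ldots,\lambda_1)$, where $\lambda_i$ is the number of cells of row $i$ in the rectangle to the left of $C$; one has $\lambda_b\ge\cdots\ge\lambda_1\ge0$, and parts equal to $0$ are allowed. Young's lattice is the set of integer partitions (Young diagrams) ordered by inclusion of diagrams, and $[\mu,\lambda]$ is the set of all Young diagrams containing $\mu$ and contained in $\lambda$. *)

(* Defs.v *)
From HB Require Import structures.
From mathcomp Require Import all_boot all_order.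

Set Implicit Arguments.
Unset Strict Implicit.
Unset Printing Implicit Defensive.

Import Order.TTheory.
Import Order.DefaultSetSubsetOrder.
Local Open Scope order_scope.

Section Ideals.
Context {d : Order.disp_t} {P : finPOrderType d}.

Definition is_ideal : pred {set P} :=
  fun I => [forall x, forall y, (x \in I) && (y <= x) ==> (y \in I)].

Lemma is_idealP (I : {set P}) :
  reflect (forall x y, x \in I -> y <= x -> y \in I) (is_ideal I).
Proof.
apply: (iffP forallP) => [h x y xI yx|h x].
  by move: (h x) => /forallP/(_ y)/implyP; apply; rewrite xI.
by apply/forallP => y; apply/implyP => /andP[]; apply: h.
Qed.

Fact is_ideal_meet : meet_closed is_ideal.
Proof.
move=> I J /is_idealP hI /is_idealP hJ; apply/is_idealP => x y.
by rewrite !inE => /andP[xI xJ] yx; rewrite (hI x y xI yx) (hJ x y xJ yx).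
Qed.

Fact is_ideal_join : join_closed is_ideal.
Proof.
move=> I J /is_idealP hI /is_idealP hJ; apply/is_idealP => x y.
rewrite !inE => /orP[xI|xJ] yx; first by rewrite (hI x y xI yx).
by rewrite (hJ x y xJ yx) orbT.
Qed.

End Ideals.

Record ideal d (P : finPOrderType d) :=
  Ideal { ideal_set :> {set P}; _ : is_ideal ideal_set }.

HB.instance Definition _ d (P : finPOrderType d) := [isSub for @ideal_set d P].
HB.instance Definition _ d (P : finPOrderType d) := [Finite of ideal P by <:].

Fact ideal_display : Order.disp_t. Proof. exact: Order.Disp tt tt. Qed.

HB.instance Definition _ d (P : finPOrderType d) :=
  Order.SubChoice_isSubLattice.Build _ _ (@is_ideal d P) ideal_display (ideal P)
    (@is_ideal_meet d P) (@is_ideal_join d P).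

Section MaximalChains.
Context {d : Order.disp_t}.

Definition is_chain (T : finPOrderType d) (C : {set T}) : bool :=
  [forall I in C, forall J in C, I >=< J].

Definition is_max_chain (T : finPOrderType d) (C : {set T}) : bool :=
  maxset (@is_chain T) C.

End MaximalChains.

Definition max_chain d (P : finPOrderType d) : Type :=
  {C : {set ideal P} | is_max_chain C}.

Definition principal_ideal d (P : finPOrderType d) (p : P) : {set P} :=
  \bigcap_(I : ideal P | p \in ideal_set I) ideal_set I.

(* The labels are shifted by one: alpha i is the element i+1 of A, and beta j is
   the element (j+1)' of B.  Either chain may be empty, and nothing is assumed
   on the relations between A and B. *)
Section TwoChains.
Context {d : Order.disp_t} {P : finPOrderType d} {a b : nat}.
Variables (alpha : 'I_a -> P) (beta : 'I_b -> P).

Definition chainA : {set P} := [set alpha i | i : 'I_a].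
Definition chainB : {set P} := [set beta j | j : 'I_b].

Definition two_chains : Prop :=
  [/\ forall i j : 'I_a, (i < j)%N -> alpha i < alpha j,
      forall i j : 'I_b, (i < j)%N -> beta i < beta j,
      chainA :|: chainB = [set: P]
    & [disjoint chainA & chainB]].

Definition xcoord (I : ideal P) : nat := #|I :&: chainA|.
Definition ycoord (I : ideal P) : nat := #|I :&: chainB|.
Definition irank (I : ideal P) : nat := (xcoord I + ycoord I)%N.

(* A maximal chain C has exactly one element c_k of each rank k = 0, ..., a + b,
   so this compares the abscissas of c_k and d_k for all k. *)
Definition le_ch (C D : max_chain P) : bool :=
  [forall I in val C, forall J in val D,
     (irank I == irank J) ==> (xcoord I <= xcoord J)%N].

(* The cell with corners (x, y) and (x+1, y+1), in row y+1, is to the left of C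
   when the vertical step of C from ordinate y to ordinate y+1 has abscissa at
   least x+1. *)
Definition cell_left (C : max_chain P) (x y : nat) : bool :=
  [exists I in val C, exists J in val C,
     [&& ycoord I == y, ycoord J == y.+1, xcoord I == xcoord J
       & (x < xcoord I)%N]].

Definition row_length (C : max_chain P) (y : nat) : nat :=
  #|[set x : 'I_a | cell_left C x y]|.

(* Partitions are listed from row b down to row 1, possibly with zero parts. *)
Definition chain_partition (C : max_chain P) : seq nat :=
  [seq row_length C j | j : 'I_b <- rev (enum 'I_b)].

Definition mu_part (j : 'I_b) : nat :=
  #|chainA :&: principal_ideal (beta j)|.

Definition lambda_part (j : 'I_b) : nat :=
  (\max_(k < a | beta j \notin principal_ideal (alpha k)) k.+1)%N.

Definition mu_seq : seq nat := [seq mu_part j | j <- rev (enum 'I_b)].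
Definition lambda_seq : seq nat := [seq lambda_part j | j <- rev (enum 'I_b)].

End TwoChains.

(* Integer partitions, without zero parts so that equality is Leibniz. *)
Record int_partition := IntPartition {
  parts :> seq nat;
  _ : sorted geq parts && all (ltn 0) parts
}.

HB.instance Definition _ := [isSub for parts].
HB.instance Definition _ := [Choice of int_partition by <:].

(* s is p written with some trailing zero parts. *)
Definition represents (s : seq nat) (p : int_partition) : Prop :=
  exists n, s = parts p ++ nseq n 0%N.

Section Young.
Implicit Types p q : int_partition.

Definition diagram p : seq (nat * nat) :=
  [seq (r, c) | r <- iota 0 (size p), c <- iota 0 (nth 0%N p r)].

Definition le_young p q : bool := all [in diagram q] (diagram p).

Lemma mem_diagram p r c : ((r, c) \in diagram p) = (c < nth 0 p r)%N.
Proof.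
apply/allpairsPdep/idP => [[r' [c' [_ + [-> ->]]]]|h].
  by rewrite mem_iota add0n.
exists r, c; rewrite !mem_iota !add0n; split=> //=.
by rewrite ltnNge; apply/negP => /(nth_default 0%N) r0; rewrite r0 in h.
Qed.

Lemma le_youngP p q :
  reflect (forall r, (nth 0 p r <= nth 0 q r)%N) (le_young p q).
Proof.
apply: (iffP allP) => [h r|h [r c]]; last first.
  by rewrite /= !mem_diagram => /leq_trans; apply.
have [-> //|] := posnP (nth 0%N p r); case E: (nth 0%N p r) => [//|c] _.
by rewrite -mem_diagram; apply: h; rewrite mem_diagram E.
Qed.

Fact le_young_refl : reflexive le_young.
Proof. by move=> p; apply/le_youngP. Qed.

Fact le_young_anti : antisymmetric le_young.
Proof.
move=> p q /andP[/le_youngP pq /le_youngP qp]; apply/val_inj.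
have E r : nth 0%N p r = nth 0%N q r by apply/eqP; rewrite eqn_leq pq qp.
have leS p' q' : (forall r, nth 0%N p' r = nth 0%N q' r) ->
    (size (parts p') <= size (parts q'))%N.
  move=> h; rewrite leqNgt; apply/negP => lt.
  case: p' h lt => p' /= /andP[_ /all_nthP p0] h lt.
  by have := p0 0%N _ lt; rewrite h nth_default.
apply: (@eq_from_nth _ 0%N) => [|r _]; last exact: E.
by apply/eqP; rewrite eqn_leq !leS.
Qed.

Fact le_young_trans : transitive le_young.
Proof.
move=> q p r /le_youngP pq /le_youngP qr; apply/le_youngP => i.
exact: leq_trans (pq i) (qr i).
Qed.

End Young.

Fact young_display : Order.disp_t. Proof. exact: Order.Disp tt tt. Qed.

HB.instance Definition _ := Order.Le_isPOrder.Build young_display int_partition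
  le_young_refl le_young_anti le_young_trans.

(* Main.v *)
Require Import Defs.
From mathcomp Require Import all_boot all_order.

Set Implicit Arguments.
Unset Strict Implicit.
Unset Printing Implicit Defensive.

Import Order.TTheory.

(** An ideal I is determined by its point (x, y) = (|I :&: A|, |I :&: B|), and
    a point of the rectangle is an ideal exactly when
      - mu_j <= x for every j < y: an ideal containing beta j contains all the
        elements of A below beta j, and there are mu_j of them;
      - x <= lambda_j for every j >= y: an ideal avoiding beta j consists of
        elements of A that are not above beta j, and there are lambda_j of them
    ([ideal_mu], [ideal_lambda] and, conversely, [ideal_at]).

    A lattice path is encoded by the abscissa f j of its vertical step in row
    j; it passes through (x, y) when f j <= x for every j < y and x <= f j for
    every j >= y. These are the inequalities above with both bounds replaced by
    f, so a nondecreasing f describes a path inside L as soon as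
    mu <= f <= lambda pointwise. Such a path is a maximal chain: an ideal off
    the path is strictly on one side of some vertical step, hence incomparable
    with one end of that step ([path_chain_max]). Conversely, a maximal chain C
    lies on the path whose f j is the largest abscissa reached by C at height
    at most j, or mu_j if that is larger; this f is admissible, so maximality
    makes C the whole path ([max_chainP]).

    Row j of the Young diagram of such a path has length f j, and comparing two
    paths rank by rank amounts to comparing their functions f pointwise
    ([le_ch_path_chain]), which is inclusion of diagrams. Since mu and lambda
    are themselves nondecreasing and mu <= lambda, they are the extreme
    admissible functions. *)

(** * Initial segments of ordinals *)

(** This turns inequalities between cardinals of initial segments of a chain
    into implications between memberships in these segments. *)
Lemma leq_from_ord n p q :
  p <= n -> (forall i : 'I_n, i < p -> i < q) -> p <= q.
Proof.
move=> pn h; rewrite leqNgt; apply/negP => qp.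
by have := h (Ordinal (leq_trans qp pn)) qp; rewrite /= ltnn.
Qed.

Lemma card_ord_ltn n m : m <= n -> #|[set i : 'I_n | i < m]| = m.
Proof.
move=> mn; rewrite -sum1_card (eq_bigl (fun i : 'I_n => i < m)) => [|i];
  last by rewrite inE.
by rewrite (big_ord_narrow mn) sum1_card card_ord.
Qed.

Lemma mem_lower_ord n (Q : {set 'I_n}) (i : 'I_n) :
    (forall k l : 'I_n, k <= l -> l \in Q -> k \in Q) ->
  (i \in Q) = (i < #|Q|).
Proof.
move=> lowerQ; apply/idP/idP => [iQ|].
  rewrite -[X in X <= _](card_ord_ltn (ltn_ord i)).
  by apply/subset_leq_card/subsetP => k; rewrite inE ltnS => /lowerQ; apply.
apply: contraTT => niQ; rewrite -leqNgt -(card_ord_ltn (ltnW (ltn_ord i))).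
apply/subset_leq_card/subsetP => k kQ; rewrite inE ltnNge; apply/negP => ik.
by rewrite (lowerQ i k ik kQ) in niQ.
Qed.

(** * Ideals of a union of two chains *)

Lemma in_principal_ideal d (P : finPOrderType d) (p q : P) :
  (q \in principal_ideal p) = (q <= p)%O.
Proof.
apply/bigcapP/idP => [h|qp I pI]; last first.
  by have /is_idealP := valP I; apply; first exact: pI.
have idI : is_ideal [set x : P | (x <= p)%O].
  by apply/is_idealP => x y; rewrite !inE => xp /le_trans; apply.
by have := h (Ideal idI); rewrite !inE lexx => /(_ isT).
Qed.

Lemma chain_inj d (P : finPOrderType d) n (gamma : 'I_n -> P) :
  (forall k l : 'I_n, k < l -> (gamma k < gamma l)%O) -> injective gamma.
Proof.
move=> incr k l e.
by case: (ltngtP k l) => [/incr|/incr|/val_inj //]; rewrite e ltxx.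
Qed.

(** An ideal meets a chain in an initial segment, so counting the elements of
    the chain in the ideal tells which ones they are. *)
Lemma mem_ideal_chain d (P : finPOrderType d) n (gamma : 'I_n -> P) (D : {set P})
    (i : 'I_n) :
    (forall k l : 'I_n, k < l -> (gamma k < gamma l)%O) -> is_ideal D ->
  (gamma i \in D) = (i < #|D :&: [set gamma k | k : 'I_n]|).
Proof.
move=> incr /is_idealP idD.
have mono (k l : 'I_n) : k <= l -> (gamma k <= gamma l)%O.
  by rewrite leq_eqVlt => /orP[/eqP/val_inj -> //|/incr/ltW].
have -> : D :&: [set gamma k | k : 'I_n] = gamma @: (gamma @^-1: D).
  apply/setP => p; rewrite !inE; apply/andP/imsetP => [[pD /imsetP[k _ e]]|[k]].
    by exists k; rewrite ?inE -?e.
  by rewrite inE => kD ->; rewrite kD imset_f.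
rewrite card_imset; last exact: chain_inj incr.
rewrite -mem_lower_ord ?inE // => k l /mono kl.
by rewrite !inE => lD; apply: idD kl.
Qed.

Section TwoChains.
Context {d : Order.disp_t} {P : finPOrderType d} {a b : nat}.
Variables (alpha : 'I_a -> P) (beta : 'I_b -> P).
Context (hAB : two_chains alpha beta).

Local Notation xc := (xcoord alpha).
Local Notation yc := (ycoord beta).
Local Notation mu := (mu_part alpha beta).
Local Notation lambda := (lambda_part alpha beta).

Lemma two_chains_ind (Q : P -> Prop) :
  (forall i, Q (alpha i)) -> (forall j, Q (beta j)) -> forall p, Q p.
Proof.
case: hAB => _ _ cov _ Qa Qb p.
have : p \in chainA alpha :|: chainB beta by rewrite cov inE.
by rewrite inE => /orP[] /imsetP[k _ ->].
Qed.

Lemma alpha_neq_beta i j : alpha i <> beta j.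
Proof.
case: hAB => _ _ _ /pred0P/(_ (alpha i)) /= + e.
by rewrite imset_f //= e imset_f.
Qed.

Lemma mem_alpha (I : ideal P) i : (alpha i \in ideal_set I) = (i < xc I).
Proof. by case: hAB => incr _ _ _; apply: mem_ideal_chain incr (valP I). Qed.

Lemma mem_beta (I : ideal P) j : (beta j \in ideal_set I) = (j < yc I).
Proof. by case: hAB => _ incr _ _; apply: mem_ideal_chain incr (valP I). Qed.

Lemma card_chain_le n (gamma : 'I_n -> P) (D : {set P}) :
  #|D :&: [set gamma k | k : 'I_n]| <= n.
Proof.
apply: leq_trans (subset_leq_card (subsetIr _ _)) _.
by apply: leq_trans (leq_imset_card _ _) _; rewrite card_ord.
Qed.

Lemma xcoord_le (I : ideal P) : xc I <= a. Proof. exact: card_chain_le. Qed.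
Lemma ycoord_le (I : ideal P) : yc I <= b. Proof. exact: card_chain_le. Qed.

Lemma mu_part_le j : mu j <= a.
Proof. by rewrite /mu_part setIC card_chain_le. Qed.

Lemma ltn_mu_part (i : 'I_a) j : (i < mu j) = (alpha i <= beta j)%O.
Proof.
case: hAB => incr _ _ _.
rewrite /mu_part setIC -mem_ideal_chain ?in_principal_ideal //.
by apply/is_idealP => x y; rewrite !in_principal_ideal => xb /le_trans; apply.
Qed.

Lemma lambda_part_le j : lambda j <= a.
Proof. by apply/bigmax_leqP => k _; apply: ltn_ord. Qed.

Lemma leq_lambda_part (i : 'I_a) j : (lambda j <= i) = (beta j <= alpha i)%O.
Proof.
case: hAB => incr _ _ _.
apply/idP/idP; last first.
  move=> ji; apply/bigmax_leqP => k; rewrite in_principal_ideal ltnNge.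
  apply: contra; rewrite leq_eqVlt => /orP[/eqP/val_inj <- //|/incr/ltW].
  exact: le_trans.
apply: contraTT => nji; rewrite -ltnNge /lambda_part.
by apply: (bigop.bigmax_sup i) => //; rewrite in_principal_ideal.
Qed.

Lemma mu_part_mono (i j : 'I_b) : i <= j -> mu i <= mu j.
Proof.
case: hAB => _ incr _ _; rewrite leq_eqVlt => /orP[/eqP/val_inj -> //|/incr ij].
apply: leq_from_ord (mu_part_le i) _ => k; rewrite !ltn_mu_part => /le_trans.
by apply; apply: ltW.
Qed.

Lemma lambda_part_mono (i j : 'I_b) : i <= j -> lambda i <= lambda j.
Proof.
case: hAB => _ incr _ _; rewrite leq_eqVlt => /orP[/eqP/val_inj -> //|/incr ij].
apply: leq_from_ord (lambda_part_le i) _ => k; rewrite !ltnNge !leq_lambda_part.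
by apply: contra; apply: le_trans; apply: ltW.
Qed.

(** Otherwise some element of A would be both below and above beta j, against
    the disjointness of the two chains. *)
Lemma mu_le_lambda j : mu j <= lambda j.
Proof.
apply: leq_from_ord (mu_part_le j) _ => k.
rewrite ltn_mu_part ltnNge leq_lambda_part => kj; apply/negP => jk.
apply: (@alpha_neq_beta k j).
by apply/le_anti; rewrite kj jk.
Qed.

(** Once I contains beta j, it contains all the elements of A below beta j. *)
Lemma ideal_mu (I : ideal P) (j : 'I_b) : j < yc I -> mu j <= xc I.
Proof.
rewrite -mem_beta => jI; apply: leq_from_ord (mu_part_le j) _ => k.
by rewrite ltn_mu_part -mem_alpha; apply/is_idealP: jI; apply: (valP I).
Qed.

(** As long as I avoids beta j, it contains no element of A above beta j. *)
Lemma ideal_lambda (I : ideal P) (j : 'I_b) : yc I <= j -> xc I <= lambda j.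
Proof.
rewrite leqNgt -mem_beta => nj; apply: leq_from_ord (xcoord_le I) _ => k.
rewrite -mem_alpha ltnNge leq_lambda_part => kI; apply: contra nj.
by apply/is_idealP: kI; apply: (valP I).
Qed.

Lemma le_ideal_coord (I J : ideal P) :
  (I <= J)%O = (xc I <= xc J) && (yc I <= yc J).
Proof.
have -> : (I <= J)%O = (ideal_set I \subset ideal_set J) by [].
apply/idP/andP => [IJ|[xIJ yIJ]]; first by split; apply/subset_leq_card/setSI.
apply/subsetP; apply: two_chains_ind => k; rewrite ?mem_alpha ?mem_beta.
  by move/leq_trans; apply.
by move/leq_trans; apply.
Qed.

(** The constraints of [ideal_mu] and [ideal_lambda] are sufficient: they rule
    out the only two ways for a union of initial segments of A and B to fail to
    be an ideal, an element of B above a missing element of A and an element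
    of A above a missing element of B. *)
Lemma ideal_at x y : x <= a -> y <= b ->
    (forall j : 'I_b, j < y -> mu j <= x) ->
    (forall j : 'I_b, y <= j -> x <= lambda j) ->
  exists2 I : ideal P, xc I = x & yc I = y.
Proof.
move=> xa yb hmu hlam.
pose S := [set p | [exists i : 'I_a, (p == alpha i) && (i < x)]
                   || [exists j : 'I_b, (p == beta j) && (j < y)]].
have [incA incB _ _] := hAB.
have Sa i : (alpha i \in S) = (i < x).
  rewrite inE; apply/orP/idP => [[]/existsP[k /andP[/eqP e kx]]|ix].
  - by rewrite (chain_inj incA e).
  - by case: (alpha_neq_beta e).
  - by left; apply/existsP; exists i; rewrite eqxx.
have Sb j : (beta j \in S) = (j < y).
  rewrite inE; apply/orP/idP => [[]/existsP[k /andP[/eqP e kx]]|ix].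
  - by case: (alpha_neq_beta (esym e)).
  - by rewrite (chain_inj incB e).
  - by right; apply/existsP; exists j; rewrite eqxx.
have idS : is_ideal S.
  apply/is_idealP.
  apply: two_chains_ind => k; apply: two_chains_ind => l; rewrite ?Sa ?Sb => kS.
  - move=> lk; apply: leq_ltn_trans kS; rewrite leqNgt; apply/negP => /incA.
    by move/lt_geF; rewrite lk.
  - rewrite -leq_lambda_part => lk; rewrite ltnNge; apply/negP => /hlam.
    by move=> /(leq_trans kS); rewrite ltnNge lk.
  - by rewrite -ltn_mu_part => /leq_trans; apply; apply: hmu.
  - move=> lk; apply: leq_ltn_trans kS; rewrite leqNgt; apply/negP => /incB.
    by move/lt_geF; rewrite lk.
exists (Ideal idS); apply/eqP; rewrite eqn_leq.
  by apply/andP; split;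
    [apply: (leq_from_ord (xcoord_le _))|apply: (leq_from_ord xa)] => i;
    rewrite -mem_alpha Sa.
by apply/andP; split;
  [apply: (leq_from_ord (ycoord_le _))|apply: (leq_from_ord yb)] => j;
  rewrite -mem_beta Sb.
Qed.

(** * Maximal chains as lattice paths *)

(** The ideals on the lattice path whose vertical step from ordinate j to j+1
    has abscissa f j: the steps below an ideal of the path are weakly to its
    left, the other ones weakly to its right. *)
Definition path_chain (f : 'I_b -> nat) : {set ideal P} :=
  [set I | [forall j : 'I_b, if j < yc I then f j <= xc I else xc I <= f j]].

Lemma path_chainP f (I : ideal P) :
  reflect ((forall j : 'I_b, j < yc I -> f j <= xc I) /\
           (forall j : 'I_b, yc I <= j -> xc I <= f j))
          (I \in path_chain f).
Proof.
rewrite inE; apply: (iffP forallP) => [h|[h1 h2] j].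
  by split=> j; have := h j; case: ltnP.
by case: ltnP => [/h1|/h2].
Qed.

Definition admissible (f : 'I_b -> nat) :=
  (forall i j : 'I_b, i <= j -> f i <= f j) /\ (forall j, mu j <= f j <= lambda j).

Lemma admissible_mu : admissible mu.
Proof. by split=> [|j]; [exact: mu_part_mono|rewrite leqnn mu_le_lambda]. Qed.

Lemma admissible_lambda : admissible lambda.
Proof. by split=> [|j]; [exact: lambda_part_mono|rewrite leqnn mu_le_lambda]. Qed.

Lemma path_chain_at f x y : admissible f -> x <= a -> y <= b ->
    (forall j : 'I_b, j < y -> f j <= x) ->
    (forall j : 'I_b, y <= j -> x <= f j) ->
  exists2 I : ideal P, I \in path_chain f & xc I = x /\ yc I = y.
Proof.
move=> [_ bnd] xa yb h1 h2; have [||I xI yI] := @ideal_at x y xa yb.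
- by move=> j /h1; apply: leq_trans; case/andP: (bnd j).
- by move=> j /h2 /leq_trans; apply; case/andP: (bnd j).
by exists I => //; apply/path_chainP; rewrite xI yI.
Qed.

(** The two ends of the vertical step in row j. *)
Lemma path_chain_corners f (j : 'I_b) : admissible f ->
  (exists2 I : ideal P, I \in path_chain f & xc I = f j /\ yc I = j) /\
  (exists2 I : ideal P, I \in path_chain f & xc I = f j /\ yc I = j.+1).
Proof.
move=> adf; have [mono bnd] := adf.
have fa : f j <= a by apply: leq_trans (lambda_part_le j); case/andP: (bnd j).
split; apply: path_chain_at => //.
- exact: ltnW.
- by move=> i /ltnW /mono.
- by move=> i; apply: mono.
- by move=> i; apply: mono.
- by move=> i /ltnW /mono.
Qed.

(** For two points of the path at heights y < y', the step in row y is weakly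
    right of the first and weakly left of the second. *)
Lemma path_chain_chain (f : 'I_b -> nat) : is_chain (path_chain f).
Proof.
have lt_le I J : I \in path_chain f -> J \in path_chain f ->
    yc I < yc J -> (I <= J)%O.
  move=> /path_chainP[_ hI] /path_chainP[hJ _] IJ.
  rewrite le_ideal_coord (ltnW IJ) andbT.
  pose j := Ordinal (leq_trans IJ (ycoord_le J)).
  exact: leq_trans (hI j (leqnn _)) (hJ j IJ).
apply/forall_inP => I IC; apply/forall_inP => J JC; rewrite /Order.comparable.
case: (ltngtP (yc I) (yc J)) => [IJ|JI|e].
- by rewrite lt_le.
- by rewrite orbC lt_le.
- by rewrite !le_ideal_coord e leqnn !andbT leq_total.
Qed.

(** An ideal J off the path is strictly above and strictly left of the bottom of
    some vertical step, or strictly below and strictly right of the top of one;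
    both ends of a step lie on the path, and J is incomparable with the one in
    question. *)
Lemma path_chain_max f : admissible f -> is_max_chain (path_chain f).
Proof.
move=> adf; apply/maxsetP; split=> [|D chD CD]; first exact: path_chain_chain.
apply/eqP; rewrite eqEsubset CD andbT; apply/subsetP => J JD.
have cmp I : I \in path_chain f ->
    (xc I <= xc J) && (yc I <= yc J) || (xc J <= xc I) && (yc J <= yc I).
  move=> /(subsetP CD) ID; rewrite -!le_ideal_coord.
  by have /forall_inP/(_ I ID)/forall_inP/(_ J JD) := chD.
apply/path_chainP; split=> j hj; rewrite leqNgt; apply/negP => lt.
  have [[I /cmp + [xI yI]] _] := path_chain_corners j adf.
  by rewrite xI yI leqNgt lt [_ <= j]leqNgt hj andbF.
have [_ [I /cmp + [xI yI]]] := path_chain_corners j adf.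
by rewrite xI yI [yc J > j]ltnNge hj [xc J <= _]leqNgt lt andbF.
Qed.

(** Only one inclusion has to be checked, as C is maximal and the path is a
    chain. *)
Lemma max_chainP (C : {set ideal P}) : is_max_chain C ->
  exists2 f, admissible f & C = path_chain f.
Proof.
move=> maxC; have /maxsetP[/forall_inP chC _] := maxC.
(* The step of C in row j starts at the last ideal of C at height at most j;
   the maximum with mu j makes f admissible without first showing that C has an
   ideal at every height. *)
pose f (j : 'I_b) := maxn (mu j) (\max_(I in C | yc I <= j) xc I).
have adf : admissible f.
  split=> [i j ij|j].
    rewrite geq_max !leq_max mu_part_mono //=; apply/orP; right.
    apply/bigmax_leqP => I /andP[IC yI]; apply: (bigop.bigmax_sup I) => //.
    by rewrite IC (leq_trans yI).
  rewrite leq_maxl geq_max mu_le_lambda /=; apply/bigmax_leqP => I /andP[_].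
  exact: ideal_lambda.
exists f => //; apply/esym/(maxsetsup maxC); first exact: path_chain_chain.
apply/subsetP => I IC; apply/path_chainP; split=> j hj.
  rewrite geq_max ideal_mu //=; apply/bigmax_leqP => J /andP[JC yJ].
  have /forall_inP/(_ J JC) := chC I IC; rewrite /Order.comparable !le_ideal_coord.
  by rewrite [yc I <= _]leqNgt (leq_ltn_trans yJ hj) andbF => /andP[].
by rewrite leq_max; apply/orP; right; apply: (bigop.bigmax_sup I); rewrite ?IC.
Qed.

(** Two ideals of the path at heights j and j+1 with the same abscissa can only
    be the ends of the vertical step in row j, so this abscissa is f j. *)
Lemma row_length_path_chain f (C : max_chain P) (j : 'I_b) :
  admissible f -> val C = path_chain f -> row_length alpha beta C j = f j.
Proof.
move=> adf eC; have [_ /(_ j)/andP[_ fl]] := adf.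
rewrite -[RHS](card_ord_ltn (leq_trans fl (lambda_part_le j))).
apply: eq_card => x; rewrite !inE /cell_left eC.
apply/exists_inP/idP => [[I /path_chainP[_ hI] /exists_inP[J _]]|xf].
  move=> /and4P[/eqP yI _ _] /leq_trans; apply; apply: hI; by rewrite yI.
have [[I IC [xI yI]] [J JC [xJ yJ]]] := path_chain_corners j adf.
exists I => //; apply/exists_inP; exists J => //.
by rewrite xI yI xJ yJ !eqxx.
Qed.

(** The height y of the point of rank k is the number of vertical steps made
    before rank k, and the step in row j starts at rank f j + j. *)
Lemma path_chain_rank f k : admissible f -> k <= a + b ->
  exists2 I : ideal P, I \in path_chain f & irank alpha beta I = k.
Proof.
move=> adf kab; have [mono bnd] := adf.
pose y := #|[set j : 'I_b | f j + j < k]|.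
have ltyE (j : 'I_b) : (j < y) = (f j + j < k).
  rewrite -mem_lower_ord ?inE // => i l il; rewrite !inE; apply: leq_ltn_trans.
  by rewrite leq_add // mono.
have yb : y <= b by rewrite -[X in _ <= X]card_ord max_card.
have below (j : 'I_b) : j < y -> f j + y <= k.
  have [-> //|y0] := posnP y; move=> jy.
  have py : y.-1 < b by rewrite prednK.
  have := ltyE (Ordinal py); rewrite /= prednK // leqnn => /esym.
  rewrite -addnS prednK //; apply: leq_trans.
  by rewrite leq_add2r mono //= -ltnS prednK.
have above (j : 'I_b) : y <= j -> k <= f j + y.
  move=> yj; have yb' : y < b := leq_ltn_trans yj (ltn_ord j).
  have := ltyE (Ordinal yb'); rewrite /= ltnn => /esym/negbT; rewrite -leqNgt.
  by move=> /leq_trans; apply; rewrite leq_add2r mono.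
have yk : y <= k.
  have [-> //|y0] := posnP y.
  have py : y.-1 < b by rewrite prednK.
  by apply: leq_trans (below (Ordinal py) _); rewrite ?leq_addl //= prednK.
have xa : k - y <= a.
  rewrite leq_subLR; have [yb'|] := ltnP y b; last first.
    by rewrite addnC => /(leq_add (leqnn a))/(leq_trans kab).
  apply: leq_trans (above (Ordinal yb') (leqnn _)) _; rewrite addnC leq_add2l.
  by apply: leq_trans (lambda_part_le (Ordinal yb')); case/andP: (bnd (Ordinal yb')).
have [||I IC [xI yI]] := path_chain_at adf xa yb.
- by move=> j /below; rewrite leq_subRL // addnC.
- by move=> j /above; rewrite leq_subLR addnC.
by exists I => //; rewrite /irank xI yI subnK.
Qed.

(** If g j < f j, then at the rank of the point (f j, j) of the first path the
    second path has already made its step in row j, so it is strictly higher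
    and strictly to the left, and the paths are not comparable in this
    direction. Conversely, if f <= g and the second path were strictly left of
    the first at some rank, it would also be strictly higher there, hence
    weakly right of its own step in the row just above the first point, while
    the first point is weakly left of the step of f in that row. *)
Lemma le_ch_path_chain f g (C D : max_chain P) :
    admissible f -> admissible g -> val C = path_chain f -> val D = path_chain g ->
  le_ch alpha beta C D <-> (forall j, f j <= g j).
Proof.
move=> adf adg eC eD; split=> [|fg].
  rewrite /le_ch eC eD => /forall_inP le_fg j; rewrite leqNgt; apply/negP => gf.
  have [[I IC [xI yI]] _] := path_chain_corners j adf.
  have [|J JC rJ] := @path_chain_rank g (irank alpha beta I) adg.
    by rewrite leq_add ?xcoord_le ?ycoord_le.
  have /forall_inP/(_ J JC) := le_fg I IC.
  rewrite rJ eqxx /= leqNgt xI => /negP; apply.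
  move/path_chainP: JC => [_ hJ].
  have [/hJ/leq_ltn_trans|] := leqP (yc J) j; first exact.
  move=> jy; rewrite -(ltn_add2r (yc J)); move: rJ; rewrite /irank xI yI => ->.
  by rewrite ltn_add2l.
rewrite /le_ch eC eD; apply/forall_inP => I /path_chainP[_ hI].
apply/forall_inP => J /path_chainP[hJ _]; apply/implyP => /eqP rIJ.
rewrite leqNgt; apply/negP => xJI.
have yIJ : yc I < yc J.
  by rewrite -(ltn_add2l (xc I)) -/(irank alpha beta I) rIJ ltn_add2r.
pose j := Ordinal (leq_trans yIJ (ycoord_le J)).
have : xc I <= xc J.
  exact: leq_trans (hI j (leqnn _)) (leq_trans (fg j) (hJ j yIJ)).
by rewrite leqNgt xJI.
Qed.

Lemma row_length_admissible (C : max_chain P) :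
  let f (j : 'I_b) := row_length alpha beta C j in
  admissible f /\ val C = path_chain f.
Proof.
have [f adf eC] := max_chainP (valP C).
have rE (j : 'I_b) : row_length alpha beta C j = f j by apply: row_length_path_chain.
split=> /=.
  by case: adf => mono bnd; split=> [i j|j]; rewrite !rE; [apply: mono|apply: bnd].
rewrite eC; apply/setP => I; rewrite !inE; apply: eq_forallb => j; by rewrite rE.
Qed.

Lemma le_ch_row_length (C D : max_chain P) :
  le_ch alpha beta C D <->
  (forall j : 'I_b, row_length alpha beta C j <= row_length alpha beta D j).
Proof.
have [aC eC] := row_length_admissible C; have [aD eD] := row_length_admissible D.
exact: le_ch_path_chain aC aD eC eD.
Qed.

Lemma admissible_max_chain f : admissible f ->
  exists C : max_chain P, forall j : 'I_b, row_length alpha beta C j = f j.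
Proof.
move=> adf; pose C : max_chain P := Sub (path_chain f) (path_chain_max adf).
by exists C => j; apply: row_length_path_chain.
Qed.

Lemma row_length_inj (C D : max_chain P) :
    (forall j : 'I_b, row_length alpha beta C j = row_length alpha beta D j) ->
  C = D.
Proof.
have [_ eC] := row_length_admissible C; have [_ eD] := row_length_admissible D.
move=> e; apply: val_inj; rewrite eC eD; apply/setP => I; rewrite !inE.
by apply: eq_forallb => j; rewrite e.
Qed.

End TwoChains.

(** * Partitions read along the rows *)

(** Only meaningful for nonincreasing s: otherwise [insubd] may fall back on the
    empty partition. *)
Definition to_partition (s : seq nat) : int_partition :=
  insubd (IntPartition (isT : sorted geq [::] && all (ltn 0) [::]))
    [seq n <- s | 0 < n].

Lemma represents_to_partition s : sorted geq s -> represents s (to_partition s).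
Proof.
move=> srt; exists (count_mem 0 s).
rewrite /to_partition val_insubd filter_all andbT sorted_filter //; last first.
  by move=> x y z yx zx; apply: leq_trans zx yx.
elim: s srt => //= n s IHs srt.
have /IHs e := path_sorted srt.
case: n srt => [|n] srt /=; last by rewrite -e.
have s0 : all (pred1 0) s.
  move: srt; rewrite path_sortedE => [/andP[+ _]|x y z yx zx];
    last exact: leq_trans zx yx.
  by apply: sub_all => n; rewrite /= leqn0.
by have /all_pred1P -> := s0; rewrite filter_nseq count_nseq /= mul1n.
Qed.

Lemma nth_represents s p r : represents s p -> nth 0 s r = nth 0 p r.
Proof.
move=> [n ->]; rewrite nth_cat nth_nseq; case: ltnP => // pr.
by rewrite if_same nth_default.
Qed.

Lemma int_partition_eq (p q : int_partition) :
  (forall r, nth 0 p r = nth 0 q r) -> p = q.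
Proof. by move=> e; apply/le_anti/andP; split; apply/le_youngP => r; rewrite e. Qed.

Lemma int_partition_nth_le (p : int_partition) r s :
  r <= s -> nth 0 p s <= nth 0 p r.
Proof.
move=> rs; have [ps|sp] := leqP (size p) s; first by rewrite nth_default.
have /andP[srt _] := valP p.
apply: (sorted_leq_nth _ _ _ srt) => //.
- by move=> x y z yx zx; apply: leq_trans zx yx.
- exact: leqnn.
- exact: leq_ltn_trans rs sp.
Qed.

Section Rows.
Context {b : nat}.
Implicit Types f g : 'I_b -> nat.

(** The order in which the parts of a path are listed, from the top row down;
    hence the [rev_ord] in [nth_rows]. *)
Definition rows f : seq nat := [seq f j | j <- rev (enum 'I_b)].

Lemma size_rows f : size (rows f) = b.
Proof. by rewrite size_map size_rev size_enum_ord. Qed.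

Lemma nth_rows f (j : 'I_b) : nth 0 (rows f) (rev_ord j) = f j.
Proof.
have sz : size (enum 'I_b) = b by rewrite size_enum_ord.
rewrite (nth_map j) ?size_rev ?sz // nth_rev ?sz //; congr f; apply: val_inj.
rewrite -[RHS](congr1 val (rev_ordK j)) /= nth_enum_ord //.
by rewrite ltn_subrL; case: (b) j => [[]|].
Qed.

Lemma sorted_rows f :
  (forall i j : 'I_b, i <= j -> f i <= f j) -> sorted geq (rows f).
Proof.
move=> mono; rewrite /rows map_rev rev_sorted sorted_map.
have: sorted ltn (map val (enum 'I_b)) by rewrite val_enum_ord iota_ltn_sorted.
rewrite sorted_map; apply: sub_sorted => i j /ltnW; exact: mono.
Qed.

Lemma le_young_rows f g p q : represents (rows f) p -> represents (rows g) q ->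
  (p <= q)%O <-> (forall j, f j <= g j).
Proof.
move=> rp rq; split=> [/le_youngP h j|h].
  by rewrite -(nth_rows f) -(nth_rows g) (nth_represents _ rp) (nth_represents _ rq).
apply/le_youngP => r; rewrite -(nth_represents _ rp) -(nth_represents _ rq).
have [br|rb] := leqP b r; first by rewrite nth_default ?size_rows.
have -> : r = rev_ord (rev_ord (Ordinal rb)) by rewrite rev_ordK.
by rewrite !nth_rows.
Qed.

End Rows.

(** * The interval of Young's lattice *)

Theorem lemma3p6 (d : Order.disp_t) (P : finPOrderType d) (a b : nat)
    (alpha : 'I_a -> P) (beta : 'I_b -> P)
    (hAB : two_chains alpha beta) :
  exists (phi : max_chain P -> int_partition) (mu lambda : int_partition)
         (Cmin Cmax : max_chain P),
    (* phi is the identification of maximal chains with partitions *)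
    (forall C : max_chain P, represents (chain_partition alpha beta C) (phi C)) /\
    represents (mu_seq alpha beta) mu /\
    represents (lambda_seq alpha beta) lambda /\
    (* phi is an isomorphism from L' onto the interval [mu, lambda] *)
    injective phi /\
    (forall nu : int_partition,
       (mu <= nu <= lambda)%O <-> exists C : max_chain P, phi C = nu) /\
    (forall C D : max_chain P, le_ch alpha beta C D = (phi C <= phi D)%O) /\
    (* the least and greatest elements of L' *)
    (forall C : max_chain P, le_ch alpha beta Cmin C) /\
    (forall C : max_chain P, le_ch alpha beta C Cmax) /\
    chain_partition alpha beta Cmin = mu_seq alpha beta /\
    chain_partition alpha beta Cmax = lambda_seq alpha beta.
Proof.
pose len (C : max_chain P) (j : 'I_b) := row_length alpha beta C j.
have adm C : admissible alpha beta (len C) by case: (row_length_admissible hAB C).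
have rep f : admissible alpha beta f -> represents (rows f) (to_partition (rows f)).
  by case=> mono _; apply/represents_to_partition/sorted_rows.
have repC C : represents (rows (len C)) (to_partition (rows (len C))).
  exact: rep (adm C).
have repmu := rep _ (admissible_mu hAB).
have replam := rep _ (admissible_lambda hAB).
have [Cmin eCmin] := admissible_max_chain hAB (admissible_mu hAB).
have [Cmax eCmax] := admissible_max_chain hAB (admissible_lambda hAB).
exists (fun C => to_partition (rows (len C))), (to_partition (mu_seq alpha beta)),
  (to_partition (lambda_seq alpha beta)), Cmin, Cmax.
split=> //; split=> //; split=> //; split.
  move=> C D e; apply: (row_length_inj hAB) => j.
  by rewrite -[LHS](nth_rows (len C)) (nth_represents _ (repC C)) e
             -(nth_represents _ (repC D)) nth_rows.
split.
  move=> nu; split=> [/andP[munu nulam]|[C <-]]; last first.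
    have [_ bnd] := adm C.
    apply/andP; split.
      by apply/(le_young_rows repmu (repC C)) => j; case/andP: (bnd j).
    by apply/(le_young_rows (repC C) replam) => j; case/andP: (bnd j).
  pose f (j : 'I_b) := nth 0 nu (rev_ord j).
  have adf : admissible alpha beta f.
    split=> [i j ij|j]; first by rewrite int_partition_nth_le // leq_sub2l.
    move/le_youngP/(_ (rev_ord j)): munu.
    move/le_youngP/(_ (rev_ord j)): nulam.
    rewrite -(nth_represents _ repmu) -(nth_represents _ replam) !nth_rows.
    by move=> -> ->.
  have [C eC] := admissible_max_chain hAB adf.
  exists C; apply: int_partition_eq => r; rewrite -(nth_represents _ (repC C)).
  have [br|rb] := leqP b r.
    (* beyond the b rows, nu vanishes because lambda does *)
    move/le_youngP/(_ r): nulam; rewrite -(nth_represents _ replam).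
    by rewrite !(nth_default _ (_ : size (rows _) <= r)) ?size_rows // leqn0 => /eqP.
  have -> : r = rev_ord (rev_ord (Ordinal rb)) by rewrite rev_ordK.
  by rewrite nth_rows /len eC.
split=> [C D|].
  apply/idP/idP => [/(le_ch_row_length hAB) h|].
    exact/(le_young_rows (repC C) (repC D)).
  by move/(le_young_rows (repC C) (repC D)) => h; apply/(le_ch_row_length hAB).
split=> [C|]; first apply/(le_ch_row_length hAB) => j.
  by rewrite eCmin; case/andP: ((adm C).2 j).
split=> [C|]; first apply/(le_ch_row_length hAB) => j.
  by rewrite eCmax; case/andP: ((adm C).2 j).
by split; apply: eq_map.
Qed.
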